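(* Let $m,n\ge1$ and let $(a,b):[[1,m]]\times[[1,n]]\to\mathbb{N}^2$, $(i,j)\mapsto(a_{ij},b_{ij})$, be any map. Then the following identity holds in $\mathrm{Sym}^n(MW_q)$: $$(n!)^{m-1}\prod_{i=1}^m\overline{\prod_{j=1}^n x_j^{a_{ij}}y_j^{b_{ij}}}=\sum_{\sigma,k,p}\left(\prod_{l=1}^{m-1}\prod_{j=1}^n c\big((b_j^\sigma)_l,\ |(a_j^\sigma)_{>l}|+|p^j_{>l}|,\ p^j_l\big)\right)\overline{\prod_{j=1}^n x_j^{|a_j^\sigma|+k_j}y_j^{|b_j^\sigma|-k_j}}.$$ Here the sum runs over $\sigma=(\sigma_1,\dots,\sigma_m)\in\{1\}\times S_n^{m-1}$ (so $\sigma_1$ is the identity), over $k=(k_1,\dots,k_n)\in\mathbb{N}^n$ with $k_j\le|b_j^\sigma|$ for all $j$, and over $p=(p^1,\dots,p^n)\in(\mathbb{N}^{m-1})^n$, $p^j=(p^j_1,\dots,p^j_{m-1})$, with $p^j_1+\cdots+p^j_{m-1}=k_j$ for all $j$; and $$a_j^\sigma=(a_{1\sigma_1^{-1}(j)},\dots,a_{m\sigma_m^{-1}(j)}),\qquad b_j^\sigma=(b_{1\sigma_1^{-1}(j)},\dots,b_{m\sigma_m^{-1}(j)}).$$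
   Context: $\mathbb{N}=\{0,1,2,\dots\}$, $[[1,m]]=\{1,\dots,m\}$, $S_n$ is the symmetric group on $[[1,n]]$. The $q$-meromorphic Weyl algebra is $MW_q=\mathbb{C}\langle x,y\rangle[q]/\langle yx-qxy-x^2\rangle$, where $\mathbb{C}\langle x,y\rangle[q]$ is the free associative complex algebra in the non-commuting variables $x,y$ with an adjoined formal variable $q$ that commutes with everything; it is an algebra over $\mathbb{C}[q]$, and the monomials $x^jy^l$ ($j,l\in\mathbb{N}$) form a $\mathbb{C}[q]$-basis. For $a,b\in\mathbb{N}$ and $0\le k\le a$, the normal coordinates $c(a,b,k)\in\mathbb{N}[q]$ are defined by the identity $y^ax^b=\sum_{k=0}^a c(a,b,k)x^{b+k}y^{a-k}$ in $MW_q$, and $c(a,b,k)=0$ for $k>a$. Symmetric powers: for an algebra $A$ over a commutative $\mathbb{C}$-algebra $R$ (here $A=MW_q$, $R=\mathbb{C}[q]$), $\mathrm{Sym}^n(A)$ is the quotient of the $R$-module $A^{\otimes n}$ (tensor product over $R$) by the submodule spanned by all $a_1\otimes\cdots\otimes a_n-a_{\sigma^{-1}(1)}\otimes\cdots\otimes a_{\sigma^{-1}(n)}$ with $a_i\in A$, $\sigma\in S_n$. The class of $a_1\otimes\cdots\otimes a_n$ is written $\overline{a_1\otimes\cdots\otimes a_n}$. $\mathrm{Sym}^n(A)$ is an associative $R$-algebra with product determined by $$n!\;\overline{a_1\otimes\cdots\otimes a_n}\cdot\overline{b_1\otimes\cdots\otimes b_n}=\sum_{\sigma\in S_n}\overline{a_1b_{\sigma^{-1}(1)}\otimes\cdots\otimes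 a_nb_{\sigma^{-1}(n)}};$$ consequently, for $a_{ij}\in A$, $(i,j)\in[[1,m]]\times[[1,n]]$, $$n!^{\,m-1}\prod_{i=1}^m\overline{\bigotimes_{j=1}^n a_{ij}}=\sum_{\sigma\in\{1\}\times S_n^{m-1}}\overline{\bigotimes_{j=1}^n\prod_{i=1}^m a_{i\sigma_i^{-1}(j)}}.$$ Notation: $\overline{\prod_{j=1}^n x_j^{a_j}y_j^{b_j}}$ denotes $\overline{x^{a_1}y^{b_1}\otimes\cdots\otimes x^{a_n}y^{b_n}}\in\mathrm{Sym}^n(MW_q)$. For a vector $v=(v_1,\dots,v_r)$ of natural numbers, $(v)_l=v_l$, $|v|=v_1+\cdots+v_r$, and $|v_{>l}|=v_{l+1}+\cdots+v_r$ (an empty sum is $0$). *)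

(* Defs.v *)
From HB Require Import structures.
From mathcomp Require Import all_boot all_order all_fingroup all_algebra.
From mathcomp Require Import boolp reals complex generic_quotient ring_quotient finmap monalg.
Set Implicit Arguments.
Unset Strict Implicit.
Unset Printing Implicit Defensive.
Import GRing.Theory.
Local Open Scope ring_scope.
Local Open Scope quotient_scope.

Section LinearQuotient.
Variables (R : comNzRingType) (V : lmodType R) (S : V -> Prop).

Definition lspan : {pred V} := fun v =>
  `[< exists s : seq (R * V),
        (forall t, t \in s -> S t.2) /\ v = \sum_(t <- s) t.1 *: t.2 >].

Lemma lspan_gen v : S v -> v \in lspan.
Proof.
move=> Sv; apply/asboolP; exists [:: (1, v)]; split.
  by move=> t; rewrite inE => /eqP->.
by rewrite big_seq1 /= scale1r.
Qed.

Lemma lspanD : {in lspan &, forall u v, u + v \in lspan}.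
Proof.
move=> u v /asboolP[s [Ss ->]] /asboolP[t [St ->]]; apply/asboolP.
exists (s ++ t); split; last by rewrite big_cat.
by move=> w; rewrite mem_cat => /orP[/Ss|/St].
Qed.

Lemma lspanZ a : {in lspan, forall v, a *: v \in lspan}.
Proof.
move=> v /asboolP[s [Ss ->]]; apply/asboolP.
exists [seq (a * t.1, t.2) | t <- s]; split.
  by move=> w /mapP[t /Ss St ->].
by rewrite big_map scaler_sumr; apply: eq_bigr => t _; rewrite scalerA.
Qed.

Lemma lspan0 : 0 \in lspan.
Proof. by apply/asboolP; exists [::]; rewrite big_nil. Qed.

Lemma lspan_zmod_closed : zmod_closed lspan.
Proof.
split=> [|u v us vs]; first exact: lspan0.
by rewrite -scaleN1r lspanD // lspanZ.
Qed.

HB.instance Definition _ := GRing.isZmodClosed.Build V lspan lspan_zmod_closed.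

(* V modulo the R-submodule spanned by S. *)
Definition lquot := Quotient.quot lspan.
HB.instance Definition _ := EqQuotient.on lquot.
HB.instance Definition _ := GRing.Zmodule.on lquot.
HB.instance Definition _ :=
  isZmodQuotient.Build V (Quotient.equiv lspan) 0 -%R +%R lquot
    (@pi_zeror _ _ _ _ _ (Quotient.quot lspan)) (@pi_oppr _ _ _ _ _ (Quotient.quot lspan))
    (@pi_addr _ _ _ _ _ (Quotient.quot lspan)).

Definition lquot_pi : V -> lquot := \pi_lquot.

Lemma lquot_piB : zmod_morphism lquot_pi.
Proof. by move=> u v; rewrite /lquot_pi raddfB. Qed.

HB.instance Definition _ :=
  GRing.isZmodMorphism.Build V lquot lquot_pi lquot_piB.

Lemma lquotP u v : lquot_pi u = lquot_pi v <-> u - v \in lspan.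
Proof.
split=> [/eqP uv|uv]; first by rewrite Quotient.idealrBE.
by apply/eqP; rewrite /lquot_pi -Quotient.idealrBE.
Qed.

Lemma lquot_reprK (x : lquot) : lquot_pi (repr x) = x.
Proof. exact: reprK. Qed.

Definition lquot_scale (a : R) (x : lquot) : lquot := lquot_pi (a *: repr x).

Lemma lquot_piZ a u : lquot_scale a (lquot_pi u) = lquot_pi (a *: u).
Proof.
apply/lquotP; rewrite -scalerBr; apply: lspanZ; apply/lquotP.
by rewrite lquot_reprK.
Qed.

Lemma lquot_scaleA a b x :
  lquot_scale a (lquot_scale b x) = lquot_scale (a * b) x.
Proof. by rewrite -[x]lquot_reprK !lquot_piZ scalerA. Qed.
Lemma lquot_scale0 x : lquot_scale 0 x = 0.
Proof. by rewrite -[x]lquot_reprK lquot_piZ scale0r raddf0. Qed.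
Lemma lquot_scale1 : left_id 1 lquot_scale.
Proof. by move=> x; rewrite -[x]lquot_reprK lquot_piZ scale1r. Qed.
Lemma lquot_scaleDr : right_distributive lquot_scale +%R.
Proof.
move=> a x y; rewrite -[x]lquot_reprK -[y]lquot_reprK.
by rewrite -raddfD !lquot_piZ scalerDr raddfD.
Qed.
Lemma lquot_scaleDl x : {morph lquot_scale^~ x : a b / a + b}.
Proof. by move=> a b; rewrite -[x]lquot_reprK !lquot_piZ scalerDl raddfD. Qed.

HB.instance Definition _ := GRing.Zmodule_isLmodule.Build R lquot
  lquot_scaleA lquot_scale1 lquot_scaleDr lquot_scaleDl.

Lemma lquot_pi_scalable : scalable lquot_pi.
Proof. by move=> a u; rewrite -lquot_piZ. Qed.

HB.instance Definition _ :=
  GRing.isScalable.Build R V lquot *:%R lquot_pi lquot_pi_scalable.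

Variables (W : lmodType R) (f : {linear V -> W}).
Hypothesis fS : forall v, S v -> f v = 0.

Lemma lquot_lift (u v : V) : lquot_pi u = lquot_pi v -> f u = f v.
Proof.
move/lquotP/asboolP => [s [Ss uvE]]; apply/eqP; rewrite -subr_eq0 -raddfB uvE.
rewrite raddf_sum big_seq big1 // => t /Ss St.
by rewrite /= linearZ_LR fS // scaler0.
Qed.

End LinearQuotient.

Section FreeLift.
Variables (R : comNzRingType) (X : choiceType) (W : lmodType R) (g : X -> W).

Definition free_lift (u : {malg R[X]}) : W :=
  \sum_(x <- msupp u) u@_x *: g x.

Lemma free_liftEw (d : {fset X}) u : (msupp u `<=` d)%fset ->
  free_lift u = \sum_(x <- d) u@_x *: g x.
Proof.
move=> ud; rewrite /free_lift (big_fset_incl _ ud) // => x _ /mcoeff_outdom ->.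
by rewrite scale0r.
Qed.

Lemma free_lift_linear : linear free_lift.
Proof.
move=> a u v.
set d := (msupp u `|` msupp v `|` msupp (a *: u + v))%fset.
rewrite !(@free_liftEw d); last first.
- exact: fsubsetUr.
- by apply/fsubsetP=> x xu; rewrite !inE xu.
- by apply/fsubsetP=> x xu; rewrite !inE xu orbT.
rewrite scaler_sumr -big_split; apply: eq_bigr => x _.
by rewrite mcoeffD mcoeffZ scalerDl scalerA.
Qed.

HB.instance Definition _ :=
  GRing.isLinear.Build R {malg R[X]} W *:%R free_lift free_lift_linear.

Lemma free_liftU x : free_lift << x >> = g x.
Proof.
by rewrite (@free_liftEw [fset x]%fset) ?msuppU_le // big_seq_fset1
  mcoeffUU scale1r.
Qed.

End FreeLift.

Lemma scalerDD_swap (R : comNzRingType) (W : lmodType R) (r s : R) (x y z w : W) :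
  s *: (r *: x + y) + (r *: z + w) = r *: (s *: x + z) + (s *: y + w).
Proof.
by rewrite !scalerDr !scalerA (mulrC s) !addrA; congr (_ + _); rewrite addrAC.
Qed.

Section SymmetricPower.
Variables (C : numFieldType) (R : comAlgType C) (A : algType R) (n : nat).
Implicit Types (f g h : {ffun 'I_n -> A}) (s : 'S_n).

Definition fupd f (i : 'I_n) (a : A) : {ffun 'I_n -> A} :=
  [ffun j => if j == i then a else f j].

(* A^(tensor n) is the free R-module on n-families in A modulo the relations
   making the class of a family R-linear in each entry. *)
Definition tens_rel (v : {malg R[{ffun 'I_n -> A}]}) : Prop :=
  exists f i (r : R) (a b : A),
    v = << fupd f i (r *: a + b) >>
        - (r *: << fupd f i a >> + << fupd f i b >>).

Definition tpow := lquot tens_rel.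
HB.instance Definition _ := GRing.Lmodule.on tpow.

Definition tens (f : {ffun 'I_n -> A}) : tpow := lquot_pi tens_rel << f >>.

Definition fperm s f : {ffun 'I_n -> A} := [ffun j => f ((s^-1)%g j)].

Definition sym_rel (v : tpow) : Prop :=
  exists f s, v = tens f - tens (fperm s f).

Definition sympow := lquot sym_rel.
HB.instance Definition _ := GRing.Lmodule.on sympow.

(* The class of f_1 (x) ... (x) f_n. *)
Definition sbar (f : {ffun 'I_n -> A}) : sympow := lquot_pi sym_rel (tens f).

Definition multilin (W : lmodType R) (phi : {ffun 'I_n -> A} -> W) :=
  forall f i (r : R) a b,
    phi (fupd f i (r *: a + b)) = r *: phi (fupd f i a) + phi (fupd f i b).
Definition symmetric_fun (W : lmodType R) (phi : {ffun 'I_n -> A} -> W) :=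
  forall s f, phi (fperm s f) = phi f.

Lemma sbar_multilin : multilin sbar.
Proof.
move=> f i r a b; rewrite /sbar -linearP; congr (lquot_pi _ _).
rewrite /tens -linearP; apply/lquotP; apply: lspan_gen.
by exists f, i, r, a, b.
Qed.

Lemma sbar_sym : symmetric_fun sbar.
Proof.
move=> s f; apply/esym/lquotP; apply: lspan_gen; by exists f, s.
Qed.

Section Lift.
Variables (W : lmodType R) (phi : {ffun 'I_n -> A} -> W).

Definition tpow_lift (u : tpow) : W := free_lift phi (repr u).
Definition sympow_lift (u : sympow) : W := tpow_lift (repr u).

Hypothesis phi_lin : multilin phi.

Lemma tpow_lift_pi u : tpow_lift (lquot_pi tens_rel u) = free_lift phi u.
Proof.
apply: (@lquot_lift _ _ tens_rel _ (free_lift phi)); last exact: lquot_reprK.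
move=> _ [f [i [r [a [b ->]]]]].
by rewrite raddfB /= linearP /= !free_liftU phi_lin subrr.
Qed.

Lemma tpow_lift_linear : linear tpow_lift.
Proof.
move=> a u v; rewrite -[u]lquot_reprK -[v]lquot_reprK -linearP.
by rewrite !tpow_lift_pi linearP.
Qed.

Hypothesis phi_sym : symmetric_fun phi.

Lemma sympow_lift_pi u : sympow_lift (lquot_pi sym_rel u) = tpow_lift u.
Proof.
pose F := HB.pack tpow_lift
  (GRing.isLinear.Build R tpow W *:%R tpow_lift tpow_lift_linear)
  : {linear tpow -> W}.
apply: (@lquot_lift _ _ sym_rel _ F); last exact: lquot_reprK.
move=> _ [f [s ->]].
by rewrite raddfB /= !tpow_lift_pi !free_liftU phi_sym subrr.
Qed.

Lemma sympow_lift_linear : linear sympow_lift.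
Proof.
move=> a u v; rewrite -[u]lquot_reprK -[v]lquot_reprK -linearP.
by rewrite !sympow_lift_pi tpow_lift_linear.
Qed.

Lemma sympow_liftE f : sympow_lift (sbar f) = phi f.
Proof. by rewrite sympow_lift_pi tpow_lift_pi free_liftU. Qed.

End Lift.

Lemma sympow_ind (P : sympow -> Prop) : P 0 ->
  (forall (r : R) u v, P u -> P v -> P (r *: u + v)) ->
  (forall f, P (sbar f)) -> forall u, P u.
Proof.
move=> P0 PD Pb u; rewrite -[u]lquot_reprK; move: (repr u) => {}u.
rewrite -[u]lquot_reprK; move: (repr u) => {}u.
rewrite [u]monalgE !raddf_sum; elim/big_rec: _ => // f v _ Pv.
have -> : << u@_f *g f >> = u@_f *: << f >> :> {malg R[{ffun 'I_n -> A}]}.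
  apply/malgP => k; rewrite mcoeffZ !mcoeffU.
  by case: eqP => _; rewrite ?mulr1n ?mulr0n ?mulr1 ?mulr0.
rewrite /= !linearZ_LR; apply: PD => //; exact: Pb.
Qed.

Section Lift2.
Variables (W : lmodType R) (phi : {ffun 'I_n -> A} -> {ffun 'I_n -> A} -> W).
Hypotheses (phi_linr : forall f, multilin (phi f))
  (phi_symr : forall f, symmetric_fun (phi f))
  (phi_linl : forall g, multilin (phi^~ g))
  (phi_syml : forall g, symmetric_fun (phi^~ g)).

Local Opaque sympow_lift.

Lemma sympow_lift2_lin v : multilin (fun f => sympow_lift (phi f) v).
Proof.
have L h := sympow_lift_linear (phi_linr h) (phi_symr h).
have L0 h : sympow_lift (phi h) 0 = 0.
  by have := L h (-1) 0 0; rewrite scaler0 addr0 scaleN1r addNr.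
move=> f i r a b /=; elim/sympow_ind: v => [|s u v uE vE|g].
- by rewrite !L0 scaler0 addr0.
- rewrite !L uE vE; exact: scalerDD_swap.
- by rewrite !sympow_liftE //; exact: phi_linl.
Qed.

Lemma sympow_lift2_sym v : symmetric_fun (fun f => sympow_lift (phi f) v).
Proof.
have L h := sympow_lift_linear (phi_linr h) (phi_symr h).
have L0 h : sympow_lift (phi h) 0 = 0.
  by have := L h (-1) 0 0; rewrite scaler0 addr0 scaleN1r addNr.
move=> t f /=; elim/sympow_ind: v => [|s u v uE vE|g].
- by rewrite !L0.
- by rewrite !L uE vE.
- by rewrite !sympow_liftE //; exact: phi_syml.
Qed.

End Lift2.

(* The scalar 1/n! of R, through the algebra structure over C. *)
Definition invfact : R := ((n`!)%:R^-1 : C)%:A.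

Definition sbar_mul f g : sympow :=
  invfact *: \sum_(s : 'S_n) sbar [ffun j => f j * g ((s^-1)%g j)].

Lemma fperm_upd s f i a : fperm s (fupd f i a) = fupd (fperm s f) (s i) a.
Proof.
apply/ffunP => j; rewrite !ffunE.
by rewrite -(inj_eq (@perm_inj _ s)) permKV.
Qed.

Lemma sbar_mul_linr f : multilin (sbar_mul f).
Proof.
move=> g i r a b; rewrite /sbar_mul scalerA mulrC -scalerA -scalerDr.
congr (_ *: _); rewrite scaler_sumr -big_split; apply: eq_bigr => s _ /=.
pose h := [ffun j => f j * g ((s^-1)%g j)].
have E c : [ffun j => f j * fupd g i c ((s^-1)%g j)] =
           fupd h (s i) (f (s i) * c).
  apply/ffunP => j; rewrite !ffunE -(inj_eq (@perm_inj _ s)) permKV.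
  by case: eqP => // ->.
by rewrite !E mulrDr -scalerAr sbar_multilin.
Qed.

Lemma sbar_mul_linl g : multilin (sbar_mul^~ g).
Proof.
move=> f i r a b; rewrite /sbar_mul scalerA mulrC -scalerA -scalerDr.
congr (_ *: _); rewrite scaler_sumr -big_split; apply: eq_bigr => s _ /=.
pose h := [ffun j => f j * g ((s^-1)%g j)].
have E c : [ffun j => fupd f i c j * g ((s^-1)%g j)] =
           fupd h i (c * g ((s^-1)%g i)).
  by apply/ffunP => j; rewrite !ffunE; case: eqP => // ->.
by rewrite !E mulrDl -scalerAl sbar_multilin.
Qed.

Lemma sbar_mul_symr f : symmetric_fun (sbar_mul f).
Proof.
move=> t g; rewrite /sbar_mul; congr (_ *: _).
rewrite [RHS](reindex_inj (mulgI t)); apply: eq_bigr => s _.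
by congr sbar; apply/ffunP => j; rewrite !ffunE invMg permM.
Qed.

Lemma sbar_mul_syml g : symmetric_fun (sbar_mul^~ g).
Proof.
move=> t f; rewrite /sbar_mul; congr (_ *: _).
rewrite (reindex_inj (mulIg t)); apply: eq_bigr => s _.
rewrite -[RHS](sbar_sym t).
by congr sbar; apply/ffunP => j; rewrite !ffunE invMg permM.
Qed.

(* Bilinear extension of sbar_mul. *)
Definition sympow_mul : sympow -> sympow -> sympow :=
  locked (fun u v => sympow_lift (fun f => sympow_lift (sbar_mul f) v) u).

Lemma lift_sbar_mul_lin v : multilin (fun f => sympow_lift (sbar_mul f) v).
Proof.
exact: (sympow_lift2_lin sbar_mul_linr sbar_mul_symr sbar_mul_linl).
Qed.

Lemma lift_sbar_mul_sym v : symmetric_fun (fun f => sympow_lift (sbar_mul f) v).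
Proof.
exact: (sympow_lift2_sym sbar_mul_linr sbar_mul_symr sbar_mul_syml).
Qed.

Lemma sympow_mulPl (r : R) u v w :
  sympow_mul (r *: u + v) w = r *: sympow_mul u w + sympow_mul v w.
Proof.
rewrite /sympow_mul -lock.
exact: (sympow_lift_linear (lift_sbar_mul_lin w) (lift_sbar_mul_sym w)).
Qed.

Lemma sympow_mulbl f v : sympow_mul (sbar f) v = sympow_lift (sbar_mul f) v.
Proof.
rewrite /sympow_mul -lock.
exact: (sympow_liftE (lift_sbar_mul_lin v) (lift_sbar_mul_sym v)).
Qed.

Lemma sympow_mulb f g : sympow_mul (sbar f) (sbar g) = sbar_mul f g.
Proof.
by rewrite sympow_mulbl; exact: (sympow_liftE (sbar_mul_linr f) (sbar_mul_symr f)).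
Qed.

Lemma sympow_mul0l w : sympow_mul 0 w = 0.
Proof.
by have := sympow_mulPl (-1) 0 0 w; rewrite scaler0 addr0 scaleN1r addNr.
Qed.

Lemma sympow_mulPr (r : R) u v w :
  sympow_mul w (r *: u + v) = r *: sympow_mul w u + sympow_mul w v.
Proof.
elim/sympow_ind: w => [|s w1 w2 E1 E2|f].
- by rewrite !sympow_mul0l scaler0 addr0.
- rewrite !sympow_mulPl E1 E2; exact: scalerDD_swap.
- rewrite !sympow_mulbl.
  exact: (sympow_lift_linear (sbar_mul_linr f) (sbar_mul_symr f)).
Qed.

Lemma sympow_mul0r w : sympow_mul w 0 = 0.
Proof.
by have := sympow_mulPr (-1) 0 0 w; rewrite scaler0 addr0 scaleN1r addNr.
Qed.

Lemma sympow_mulDl : left_distributive sympow_mul +%R.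
Proof. by move=> u v w; rewrite -[u]scale1r sympow_mulPl !scale1r. Qed.
Lemma sympow_mulDr : right_distributive sympow_mul +%R.
Proof. by move=> w u v; rewrite -[u]scale1r sympow_mulPr !scale1r. Qed.
Lemma sympow_mulZl (r : R) u v : sympow_mul (r *: u) v = r *: sympow_mul u v.
Proof. by rewrite -[r *: u]addr0 sympow_mulPl sympow_mul0l addr0. Qed.
Lemma sympow_mulZr (r : R) u v : sympow_mul u (r *: v) = r *: sympow_mul u v.
Proof. by rewrite -[r *: v]addr0 sympow_mulPr sympow_mul0r addr0. Qed.
Lemma sympow_mulsl I (r : seq I) (F : I -> sympow) v :
  sympow_mul (\sum_(i <- r) F i) v = \sum_(i <- r) sympow_mul (F i) v.
Proof.
elim: r => [|i r IH]; first by rewrite !big_nil sympow_mul0l.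
by rewrite !big_cons sympow_mulDl IH.
Qed.
Lemma sympow_mulsr I (r : seq I) (F : I -> sympow) v :
  sympow_mul v (\sum_(i <- r) F i) = \sum_(i <- r) sympow_mul v (F i).
Proof.
elim: r => [|i r IH]; first by rewrite !big_nil sympow_mul0r.
by rewrite !big_cons sympow_mulDr IH.
Qed.

Lemma invfactK : (n`!)%:R * invfact = 1.
Proof.
rewrite /invfact -scalerAr mulr1 -scaler_nat scalerA mulVf ?scale1r //.
by rewrite Num.Theory.pnatr_eq0 -lt0n fact_gt0.
Qed.

Definition sympow_one : sympow := sbar [ffun=> 1].

Lemma sbar_mul_const f u :
  (forall s : 'S_n, u s = sbar f) -> invfact *: \sum_(s : 'S_n) u s = sbar f.
Proof.
move=> uE; rewrite (eq_bigr (fun=> sbar f)) // sumr_const.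
by rewrite card_Sn -scaler_nat scalerA mulrC invfactK scale1r.
Qed.

Lemma sympow_mul1l : left_id sympow_one sympow_mul.
Proof.
move=> u; elim/sympow_ind: u => [|r u v uE vE|f].
- exact: sympow_mul0r.
- by rewrite sympow_mulPr uE vE.
- rewrite sympow_mulb; apply: sbar_mul_const => s; rewrite -[RHS](sbar_sym s).
  by congr sbar; apply/ffunP => j; rewrite !ffunE mul1r.
Qed.

Lemma sympow_mul1r : right_id sympow_one sympow_mul.
Proof.
move=> u; elim/sympow_ind: u => [|r u v uE vE|f].
- exact: sympow_mul0l.
- by rewrite sympow_mulPl uE vE.
- rewrite sympow_mulb; apply: sbar_mul_const => s.
  by congr sbar; apply/ffunP => j; rewrite !ffunE mulr1.
Qed.

Lemma sympow_mulA : associative sympow_mul.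
Proof.
move=> u v w; elim/sympow_ind: u => [|r u1 u2 E1 E2|f].
- by rewrite !sympow_mul0l.
- by rewrite !sympow_mulPl E1 E2.
elim/sympow_ind: v => [|r u1 u2 E1 E2|g].
- by rewrite sympow_mul0r !sympow_mul0l sympow_mul0r.
- rewrite (sympow_mulPl r u1 u2 w) (sympow_mulPr r _ _ (sbar f)).
  by rewrite (sympow_mulPr r u1 u2) sympow_mulPl E1 E2.
elim/sympow_ind: w => [|r u1 u2 E1 E2|h].
- by rewrite !sympow_mul0r.
- rewrite (sympow_mulPr r u1 u2 (sbar g)) (sympow_mulPr r _ _ (sbar f)).
  by rewrite (sympow_mulPr r u1 u2) E1 E2.
rewrite !sympow_mulb [sbar_mul g h]/sbar_mul [sbar_mul f g]/sbar_mul.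
rewrite sympow_mulZl sympow_mulZr sympow_mulsl sympow_mulsr; congr (_ *: _).
under eq_bigr do rewrite sympow_mulb /sbar_mul.
under [RHS]eq_bigr do rewrite sympow_mulb /sbar_mul.
rewrite -!scaler_sumr; congr (_ *: _).
rewrite exchange_big; apply: eq_bigr => t _ /=.
rewrite [RHS](reindex_inj (mulIg t)); apply: eq_bigr => s _.
congr sbar; apply/ffunP => j; rewrite !ffunE invMg permM mulrA.
by [].
Qed.

HB.instance Definition _ := GRing.Zmodule_isPzRing.Build sympow
  sympow_mulA sympow_mul1l sympow_mul1r sympow_mulDl sympow_mulDr.

Lemma sympow_mulE f g :
  (sbar f * sbar g) *+ n`! =
  \sum_(s : 'S_n) sbar [ffun j => f j * g ((s^-1)%g j)].
Proof.
rewrite {1}/GRing.mul /= sympow_mulb -scaler_nat scalerA invfactK.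
exact: scale1r.
Qed.

End SymmetricPower.

Lemma malg_scaleAr (R : comNzRingType) (K : monomType) (a : R)
  (u v : {malg R[K]}) : a *: (u * v) = u * (a *: v).
Proof.
rewrite (malgMEw (fsubset_refl (msupp u)) (msuppZ_le a v)).
rewrite malgME scaler_sumr; apply: eq_bigr => k _.
rewrite scaler_sumr; apply: eq_bigr => l _.
apply/malgP => i; rewrite !(mcoeffZ, mcoeffU).
by rewrite mulrCA !mulrnAr.
Qed.

Section Augmentation.
Variables (R : comNzRingType) (B : lalgType R) (e : B -> R).
Variables (x y : B) (q : R).
Hypothesis eB : forall u v, e (u - v) = e u - e v.
Hypothesis eZ : forall a u, e (a *: u) = a * e u.
Hypothesis eM : forall u v, e (u * v) = e u * e v.

Lemma augmentation_relator :
  e x = 0 -> e (y * x - q *: (x * y) - x ^+ 2) = 0.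
Proof. by move=> ex; rewrite expr2 !eB eZ !eM ex mul0r !mulr0 !subr0. Qed.

Lemma augmentation_ideal a u w v : e w = 0 -> e (a *: (u * w * v)) = 0.
Proof. by move=> ew; rewrite eZ !eM ew mulr0 mul0r mulr0. Qed.
End Augmentation.

(* ncrec is an explicit solution of the identity defining the normal
   coordinates; it only serves to prove that they exist. *)
Fixpoint qint (b : nat) : {poly nat} := if b is b'.+1 then 1 + 'X * qint b' else 0.

Fixpoint ncrec (a b k : nat) : {poly nat} :=
  if a is a'.+1 then
    'X ^+ (b + k) * ncrec a' b k +
    (if k is k'.+1 then qint (b + k') * ncrec a' b k' else 0)
  else (k == 0%N)%:R.

Lemma ncrec_gt a b k : (a < k)%N -> ncrec a b k = 0.
Proof.
elim: a k => [|a IH] [|k] //= ak.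
by rewrite !IH ?mulr0 ?addr0 //; apply: ltnW.
Qed.

Section NormalOrder.
Variables (R : comNzRingType) (q : R) (B : algType R) (x y : B).
Variable (phi : {rmorphism {poly nat} -> R}).
Hypothesis phiX : phi 'X = q.
Hypothesis yx : y * x = q *: (x * y) + x ^+ 2.

Lemma yxX b :
  y * x ^+ b = phi ('X ^+ b) *: (x ^+ b * y)
                   + phi (qint b) *: x ^+ b.+1.
Proof.
elim: b => [|b IH].
  by rewrite !expr0 rmorph1 rmorph0 mulr1 mul1r scale1r scale0r addr0.
rewrite exprS mulrA yx mulrDl -scalerAl -[x * y * _]mulrA IH mulrDr -!scalerAr.
rewrite !mulrA -exprS -exprS -exprD scalerDr !scalerA.
rewrite /= rmorphD rmorph1 !rmorphM phiX scalerDl scale1r -addrA.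
rewrite [in RHS]exprS -['X^b]/('X ^+ b) rmorphM phiX; congr (_ + _).
by rewrite addrC add2n.
Qed.

Lemma normal_order a b : y ^+ a * x ^+ b =
  \sum_(k < a.+1) phi (ncrec a b k) *: (x ^+ (b + k) * y ^+ (a - k)).
Proof.
elim: a => [|a IH].
  rewrite big_ord_recl big_ord0 /= rmorph1 scale1r addr0 addn0.
  by rewrite !expr0 mul1r mulr1.
rewrite exprS -mulrA IH mulr_sumr.
transitivity (\sum_(k < a.+1)
   (phi ('X ^+ (b + k) * ncrec a b k) *: (x ^+ (b + k) * y ^+ (a.+1 - k))
   + phi (qint (b + k) * ncrec a b k) *:
       (x ^+ (b + k.+1) * y ^+ (a.+1 - k.+1)))).
  apply: eq_bigr => k _; rewrite -scalerAr mulrA yxX mulrDl scalerDr.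
  rewrite -!scalerAl !scalerA -mulrA -exprS -subSn ?leq_ord //.
  rewrite !rmorphM addnS subSS.
  by congr (_ *: _ + _ *: _); rewrite mulrC.
rewrite big_split /= .
have -> : \sum_(k < a.+2) phi (ncrec a.+1 b k) *:
            (x ^+ (b + k) * y ^+ (a.+1 - k)) =
  \sum_(k < a.+2) phi ('X ^+ (b + k) * ncrec a b k) *:
            (x ^+ (b + k) * y ^+ (a.+1 - k))
  + \sum_(k < a.+2) phi (if k : nat is k'.+1 then qint (b + k') * ncrec a b k'
       else 0) *: (x ^+ (b + k) * y ^+ (a.+1 - k)).
  rewrite -big_split; apply: eq_bigr => k _ /=.
  by rewrite -scalerDl -rmorphD.
congr (_ + _).
  rewrite [RHS]big_ord_recr /= ncrec_gt // mulr0 rmorph0 scale0r.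
  by rewrite addr0.
rewrite [RHS]big_ord_recl /= rmorph0 scale0r add0r.
by apply: eq_bigr => k _.
Qed.

End NormalOrder.

Section MeromorphicWeyl.
Variable C : numFieldType.

(* C<x,y>[q], q being central, is the free algebra on x and y over C[q]; the
   letters x and y are [false] and [true], and q is ['X : {poly C}]. *)
Definition freexy := {malg {poly C}[{fmonom bool}]}.
HB.instance Definition _ := GRing.Lalgebra.on freexy.

Definition freeX : freexy := << fmu false >>.
Definition freeY : freexy := << fmu true >>.

Definition mw_relator : freexy :=
  freeY * freeX - 'X *: (freeX * freeY) - freeX ^+ 2.

Lemma freexy_scaleAr (a : {poly C}) (u v : freexy) :
  a *: (u * v) = u * (a *: v).
Proof.
exact: malg_scaleAr.
Qed.

(* The span of the products u * relator * v is a two-sided ideal. *)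
Definition mw_rel (w : freexy) : Prop := exists u v, w = u * mw_relator * v.

Definition MW := lquot mw_rel.
HB.instance Definition _ := GRing.Lmodule.on MW.

Lemma mw_idealM (u v w : freexy) :
  w \in lspan mw_rel -> u * w * v \in lspan mw_rel.
Proof.
move/asboolP => [s [Ss ->]].
rewrite mulr_sumr mulr_suml big_seq; elim/big_rec: _ => [|t z ts zI].
  exact: lspan0.
apply: lspanD => //; have [u' [v' ->]] := Ss t ts.
rewrite -freexy_scaleAr -scalerAl; apply: lspanZ; apply: lspan_gen.
by exists (u * u'), (v' * v); rewrite !mulrA.
Qed.

Local Notation pi := (lquot_pi mw_rel).

Definition MW_mul : MW -> MW -> MW := locked (fun u v => pi (repr u * repr v)).
Definition MW_one : MW := pi 1.

Lemma MW_piM u v : MW_mul (pi u) (pi v) = pi (u * v).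
Proof.
rewrite /MW_mul -lock; apply/lquotP; set u' := repr _; set v' := repr _.
have -> : u' * v' - u * v = 1 * (u' - u) * v' + u * (v' - v) * 1.
  by rewrite mul1r mulr1 mulrBl mulrBr addrA subrK.
by apply: lspanD; apply: mw_idealM; apply/lquotP; rewrite lquot_reprK.
Qed.

Lemma MW_mulA : associative MW_mul.
Proof.
move=> u v w; rewrite -[u]lquot_reprK -[v]lquot_reprK -[w]lquot_reprK.
by rewrite !MW_piM mulrA.
Qed.
Lemma MW_mul1l : left_id MW_one MW_mul.
Proof. by move=> u; rewrite -[u]lquot_reprK MW_piM mul1r. Qed.
Lemma MW_mul1r : right_id MW_one MW_mul.
Proof. by move=> u; rewrite -[u]lquot_reprK MW_piM mulr1. Qed.
Lemma MW_mulDl : left_distributive MW_mul +%R.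
Proof.
move=> u v w; rewrite -[u]lquot_reprK -[v]lquot_reprK -[w]lquot_reprK.
by rewrite -raddfD !MW_piM mulrDl raddfD.
Qed.
Lemma MW_mulDr : right_distributive MW_mul +%R.
Proof.
move=> u v w; rewrite -[u]lquot_reprK -[v]lquot_reprK -[w]lquot_reprK.
by rewrite -raddfD !MW_piM mulrDr raddfD.
Qed.

Lemma MW_one_neq0 : MW_one != 0.
Proof.
apply/eqP; rewrite -[0](raddf0 pi) => /lquotP; rewrite subr0.
pose e : {rmorphism {malg {poly C}[{fmonom bool}]} -> {poly C}} :=
  mcoeff (@mone {fmonom bool}).
have eX b : e << fmu b >> = 0.
  rewrite /e /= mcoeffU1; case: eqP => // /(congr1 (fun k : {fmonom bool} => size k)).
  by rewrite fm1 fmuE.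
have eZ a (u : freexy) : e (a *: u) = a * e u by exact: mcoeffZ.
have eM (u v : freexy) : e (u * v) = e u * e v by exact: rmorphM.
have eB (u v : freexy) : e (u - v) = e u - e v by exact: rmorphB.
have e0 : e mw_relator = 0.
  exact: (@augmentation_relator _ freexy e freeX freeY 'X eB eZ eM (eX false)).
move/asboolP => [s [Ss /(congr1 e)]].
rewrite raddf_sum rmorph1 big_seq big1 => [/eqP|t /Ss [u [v E]]].
  by rewrite oner_eq0.
by rewrite E; exact: (@augmentation_ideal _ freexy e eZ eM t.1 u mw_relator v e0).
Qed.

HB.instance Definition _ := GRing.Zmodule_isNzRing.Build MW
  MW_mulA MW_mul1l MW_mul1r MW_mulDl MW_mulDr MW_one_neq0.

Lemma MW_scaleAl (a : {poly C}) (u v : MW) : a *: (u * v) = (a *: u) * v.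
Proof.
have Z (b : {poly C}) (w : freexy) : b *: pi w = pi (b *: w) by exact: lquot_piZ.
rewrite /GRing.mul /= -[u]lquot_reprK -[v]lquot_reprK.
by rewrite MW_piM !Z MW_piM; congr (pi _); exact: scalerAl.
Qed.
HB.instance Definition _ :=
  GRing.Lmodule_isLalgebra.Build {poly C} MW MW_scaleAl.

Lemma MW_scaleAr (a : {poly C}) (u v : MW) : a *: (u * v) = u * (a *: v).
Proof.
have Z (b : {poly C}) (w : freexy) : b *: pi w = pi (b *: w) by exact: lquot_piZ.
rewrite /GRing.mul /= -[u]lquot_reprK -[v]lquot_reprK.
by rewrite MW_piM !Z MW_piM; congr (pi _); exact: freexy_scaleAr.
Qed.
HB.instance Definition _ :=
  GRing.Lalgebra_isAlgebra.Build {poly C} MW MW_scaleAr.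

Definition MWx : MW := pi freeX.
Definition MWy : MW := pi freeY.

Lemma MW_yx : MWy * MWx = 'X *: (MWx * MWy) + MWx ^+ 2.
Proof.
apply/eqP; rewrite -subr_eq0 opprD addrA expr2.
rewrite {1 2 3}/GRing.mul /= !MW_piM -linearZ_LR -!raddfB; apply/eqP.
rewrite -[0](raddf0 pi); apply/lquotP; rewrite subr0; apply: lspan_gen.
by exists 1, 1; rewrite mul1r mulr1 -expr2.
Qed.

(* The map N[q] -> C[q]. *)
Definition natpoly (p : {poly nat}) : {poly C} := map_poly (GRing.natmul 1) p.

Definition normal_coord_spec (c : nat -> nat -> nat -> {poly nat}) : Prop :=
  (forall a b : nat, MWy ^+ a * MWx ^+ b =
     \sum_(k < a.+1) natpoly (c a b k) *: (MWx ^+ (b + k) * MWy ^+ (a - k))) /\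
  (forall a b k : nat, (a < k)%N -> c a b k = 0).

Lemma ncrec_spec : normal_coord_spec ncrec.
Proof.
split=> [a b|a b k]; last exact: ncrec_gt.
exact: (normal_order (phi := map_poly (GRing.natmul (1 : C)))
         (map_polyX _) MW_yx).
Qed.

Lemma normal_coord_ex : exists c, normal_coord_spec c.
Proof. by exists ncrec; exact: ncrec_spec. Qed.

(* The normal coordinates c(a,b,k), as the solution of the defining identity. *)
Definition normal_coord : nat -> nat -> nat -> {poly nat} :=
  sval (cid normal_coord_ex).

Lemma normal_coordP : normal_coord_spec normal_coord.
Proof. exact: svalP. Qed.

Definition sym_monomial (n : nat) (a b : 'I_n -> nat) : sympow MW n :=
  sbar [ffun j => MWx ^+ a j * MWy ^+ b j].

End MeromorphicWeyl.

Section Vectors.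
Variables m n : nat.

Definition vsum (r : nat) (v : 'I_r -> nat) : nat := (\sum_(i < r) v i)%N.

(* |v_{>l}|; entries and l are both numbered from 0. *)
Definition vtail (r : nat) (v : 'I_r -> nat) (l : nat) : nat :=
  (\sum_(i < r | (l < i)%N) v i)%N.

(* The vector (a_{1 s_1^-1(j)}, ..., a_{m s_m^-1(j)}). *)
Definition permvec (a : 'I_m -> 'I_n -> nat) (s : {ffun 'I_m -> 'S_n})
  (j : 'I_n) : 'I_m -> nat := fun i => a i ((s i)^-1 j)%g.

Definition fixes_first (s : {ffun 'I_m -> 'S_n}) : bool :=
  [forall i : 'I_m, (i == 0 :> nat) ==> (s i == 1%g)].

(* As |permvec b s j| <= entry_sum b for all s and j, families of naturals k_j and
   p^j_l with k_j <= |permvec b s j| and p^j_1 + ... + p^j_(m-1) = k_j take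
   their values in 'I_(entry_sum b).+1, so that type may index them. *)
Definition entry_sum (b : 'I_m -> 'I_n -> nat) : nat := (\sum_i \sum_j b i j)%N.

Lemma permvec_le_sum b s j : (vsum (permvec b s j) <= entry_sum b)%N.
Proof.
apply: leq_sum => i _.
by rewrite /permvec (bigD1 ((s i)^-1 j)%g) //= leq_addr.
Qed.

End Vectors.

(* Main.v *)
Require Import Defs.
From mathcomp Require Import all_boot all_order all_fingroup all_algebra.
From mathcomp Require Import boolp reals complex.
Import GRing.Theory.
Local Open Scope ring_scope.
Local Open Scope complex_scope.

(** The identity combines three expansions.
    - In a symmetric power of any algebra, iterating the rule for a product of
      two classes gives n!^(m-1) times a product of m classes as a sum, over the
      families of permutations starting with the identity, of the classes of the
      slotwise products ([sbar_prod]).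
    - For a fixed family, slot j holds the word
      x^(a_1) y^(b_1) ... x^(a_m) y^(b_m) in the Weyl algebra.  Its normal form
      is found from the right: once the tail is x^A y^B, the block y^(b_1) must
      cross x^A, which produces the coefficient c(b_1, A, p_1) and raises the
      exponent of x by p_1.  So A is the sum of the later a's and the later p's
      ([normal_ordering]).
    - A class is linear in each slot, so the n normal forms multiply out into a
      sum over one vector p^j per slot ([multilin_expand]).
    The variable k of the identity only records the sums of the vectors p^j, and
    sorting the p's by these sums is legitimate because the coefficient vanishes
    as soon as one p^j has a larger sum than its word has letters y
    ([sum_by_entry_sums], [ordering_coef_eq0]).

    All three expansions go by induction on a length, and each step splits a sum
    over families of length r+1 into a distinguished entry and a family of length
    r: the last factor of the product, the first block of the word, the first
    slot of the tensor.  [big_finsert] is that splitting. *)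

(** * Families with a distinguished entry *)

Section InsertEntry.
Variables (T : Type) (r : nat).

Definition finsert (h : 'I_r.+1) (t : T) (f : {ffun 'I_r -> T}) :
    {ffun 'I_r.+1 -> T} := [ffun i => oapp f t (unlift h i)].

Lemma finsert_at h t f : finsert h t f h = t.
Proof. by rewrite ffunE unlift_none. Qed.

Lemma finsert_lift h t f i : finsert h t f (lift h i) = f i.
Proof. by rewrite ffunE liftK. Qed.

Lemma finsert_eta h (f : {ffun 'I_r.+1 -> T}) :
  finsert h (f h) [ffun i => f (lift h i)] = f.
Proof.
by apply/ffunP=> i; rewrite ffunE; case: unliftP => [j|] -> //=; rewrite ffunE.
Qed.

End InsertEntry.
Arguments finsert [T r] h t f.

Lemma big_finsert (V : nmodType) (T : finType) (r : nat) (h : 'I_r.+1)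
    (P : pred {ffun 'I_r.+1 -> T}) (G : {ffun 'I_r.+1 -> T} -> V) :
  \sum_(f | P f) G f =
  \sum_(t : T) \sum_(f : {ffun 'I_r -> T} | P (finsert h t f)) G (finsert h t f).
Proof.
rewrite pair_big_dep /=.
rewrite (reindex (fun p : T * {ffun 'I_r -> T} => finsert h p.1 p.2)) //=.
exists (fun f => (f h, [ffun i => f (lift h i)])) => [[t f]|f] _ /=; last first.
  exact: finsert_eta.
by rewrite finsert_at; congr pair; apply/ffunP=> i; rewrite ffunE finsert_lift.
Qed.

(** * Expansion of multilinear maps *)

Section Multilinear.
Variables (C : numFieldType) (R : comAlgType C) (A : algType R) (W : lmodType R).

Lemma fupd_finsert (n : nat) (h : 'I_n.+1) (a b : A) (f : {ffun 'I_n -> A}) :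
  fupd (finsert h b f) h a = finsert h a f.
Proof.
by apply/ffunP=> j; rewrite !ffunE; case: unliftP => [i|] -> //=;
  rewrite ?eqxx // eq_sym (negPf (neq_lift _ _)).
Qed.

Lemma fupd_finsert_lift (n : nat) (h : 'I_n.+1) (a b : A) f (i : 'I_n) :
  fupd (finsert h b f) (lift h i) a = finsert h b (fupd f i a).
Proof.
apply/ffunP=> j; rewrite !ffunE; case: unliftP => [k|] -> /=.
  by rewrite !ffunE (inj_eq lift_inj).
by rewrite (negPf (neq_lift _ _)).
Qed.

Lemma multilin_finsert (n : nat) (phi : {ffun 'I_n.+1 -> A} -> W) h a :
  multilin phi -> multilin (fun f => phi (finsert h a f)).
Proof. by move=> phiP f i r b c; rewrite -!fupd_finsert_lift phiP. Qed.

Lemma multilin_finsert_sum (n : nat) (phi : {ffun 'I_n.+1 -> A} -> W) h f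
    (I : Type) (s : seq I) (c : I -> R) (M : I -> A) :
  multilin phi -> phi (finsert h (\sum_(i <- s) c i *: M i) f) =
  \sum_(i <- s) c i *: phi (finsert h (M i) f).
Proof.
move=> phiP.
have phiS r a b : phi (finsert h (r *: a + b) f) =
    r *: phi (finsert h a f) + phi (finsert h b f).
  have E d : finsert h d f = fupd (finsert h 0 f) h d by rewrite fupd_finsert.
  by rewrite (E (r *: a + b)) (E a) (E b) phiP.
elim: s => [|i s IH]; last by rewrite !big_cons phiS IH.
rewrite !big_nil; have := phiS (-1) 0 0.
by rewrite scaler0 addr0 scaleN1r addNr.
Qed.

(** Expanding the first slot by linearity leaves, for each choice of a term
    there, a multilinear map of the remaining slots; hence induction on n. *)
Lemma multilin_expand (n : nat) (phi : {ffun 'I_n -> A} -> W) (P : finType)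
    (c : 'I_n -> P -> R) (M : 'I_n -> P -> A) :
  multilin phi -> phi [ffun j => \sum_p c j p *: M j p] =
  \sum_(t : {ffun 'I_n -> P})
    (\prod_j c j (t j)) *: phi [ffun j => M j (t j)].
Proof.
elim: n phi c M => [|n IH] phi c M phiP.
  rewrite (big_pred1 (ffun0 (card_ord 0))); last first.
    by move=> t; apply/esym/eqP/ffunP => -[].
  by rewrite big_ord0 scale1r; congr phi; apply/ffunP=> -[].
rewrite (big_finsert _ _ _ ord0) -[X in phi X](finsert_eta _ _ ord0) ffunE.
rewrite multilin_finsert_sum //; apply: eq_bigr => p _.
have -> : [ffun i => [ffun j => \sum_p0 c j p0 *: M j p0] (lift ord0 i)] =
    [ffun i => \sum_p0 c (lift ord0 i) p0 *: M (lift ord0 i) p0]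
    :> {ffun 'I_n -> A}.
  by apply/ffunP=> i; rewrite !ffunE.
rewrite (IH (fun f => phi (finsert ord0 (M ord0 p) f))); last exact: multilin_finsert.
rewrite scaler_sumr; apply: eq_bigr => t _.
rewrite scalerA big_ord_recl finsert_at; congr (_ * _ *: phi _).
  by apply: eq_bigr => i _; rewrite finsert_lift.
apply/ffunP=> j; rewrite !ffunE; case: unliftP => [i|] -> //=.
by rewrite ffunE.
Qed.

End Multilinear.

(** * Products of classes in a symmetric power *)

Section PowerProduct.
Variables (C : numFieldType) (R : comAlgType C) (A : algType R) (n : nat).

Lemma fixes_first_finsert_max (r : nat) (t : 'S_n) (s : {ffun 'I_r.+1 -> 'S_n}) :
  fixes_first (finsert ord_max t s) = fixes_first s.
Proof.
apply/forallP/forallP => fs i; apply/implyP => /eqP i0.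
  by have := fs (lift ord_max i); rewrite finsert_lift lift_max i0.
case: (unliftP ord_max i) i0 => [j|] -> // j0; rewrite finsert_lift.
by have := fs j; rewrite -(lift_max j) j0.
Qed.

(** The factors are peeled off from the right: multiplying on the right by one
    more class composes each slotwise product with an unconstrained new
    permutation and costs one more n!, while the first permutation stays the
    identity.  A single factor needs no permutation, hence the exponent r. *)
Lemma sbar_prod (r : nat) (F : 'I_r.+1 -> {ffun 'I_n -> A}) :
  (\prod_(i < r.+1) sbar (F i)) *+ n`! ^ r =
  \sum_(s : {ffun 'I_r.+1 -> 'S_n} | fixes_first s)
    sbar [ffun j => \prod_(i < r.+1) F i ((s i)^-1 j)%g].
Proof.
elim: r F => [|r IH] F.
  rewrite (big_pred1 [ffun=> 1%g]) => [|s].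
    rewrite big_ord1 expn0 mulr1n; congr sbar; apply/ffunP => j.
    by rewrite !ffunE big_ord1 ffunE invg1 perm1.
  apply/forallP/eqP => [fs|-> i]; last by rewrite ffunE eqxx implybT.
  by apply/ffunP => i; rewrite ffunE; have := fs i; rewrite ord1 => /eqP.
rewrite big_ord_recr /= expnSr mulrnA -mulrnAl IH mulr_suml -sumrMnl.
rewrite [RHS](big_finsert _ _ _ ord_max).
rewrite [RHS](exchange_big_dep (@fixes_first r.+1 n)) /= => [|t s _]; last first.
  by rewrite fixes_first_finsert_max.
apply: eq_bigr => s s1; rewrite sympow_mulE.
apply: eq_big => [t|t _]; first by rewrite fixes_first_finsert_max s1.
congr sbar; apply/ffunP => j; rewrite [LHS]ffunE ffunE [RHS]ffunE [RHS]big_ord_recr /=.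
rewrite finsert_at; congr (_ * _); apply: eq_bigr => i _.
have -> : widen_ord (leqnSn r.+1) i = lift ord_max i.
  by apply: val_inj; exact: esym (lift_max i).
by rewrite finsert_lift.
Qed.

End PowerProduct.

(** * Normal form of a word in the Weyl algebra *)

Section NormalOrdering.
Variable C : numFieldType.
Local Notation x := (MWx C).
Local Notation y := (MWy C).
Local Notation c := (normal_coord C).

Lemma natpolyM (p q : {poly nat}) : natpoly C (p * q) = natpoly C p * natpoly C q.
Proof. exact: (rmorphM (map_poly (GRing.natmul (1 : C)))). Qed.

Lemma natpoly_prod (I : Type) (s : seq I) (F : I -> {poly nat}) :
  natpoly C (\prod_(i <- s) F i) = \prod_(i <- s) natpoly C (F i).
Proof. exact: (rmorph_prod (map_poly (GRing.natmul (1 : C)))). Qed.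

Lemma natpoly0 : natpoly C 0 = 0.
Proof. exact: (rmorph0 (map_poly (GRing.natmul (1 : C)))). Qed.

Lemma natpoly1 : natpoly C 1 = 1.
Proof. exact: (rmorph1 (map_poly (GRing.natmul (1 : C)))). Qed.

(** Since c(d, e, k) vanishes for k > d, the range of k may be any 'I_N.+1 with
    N >= d.  This lets one index type serve all the blocks of a word. *)
Lemma normal_coord_sum (N d e : nat) : (d <= N)%N ->
  y ^+ d * x ^+ e =
  \sum_(k < N.+1) natpoly C (c d e k) *: (x ^+ (e + k) * y ^+ (d - k)).
Proof.
move=> dN; have [-> c0] := normal_coordP C.
rewrite (big_ord_widen_cond N.+1 xpredT
  (fun k => natpoly C (c d e k) *: (x ^+ (e + k) * y ^+ (d - k)))) //.
rewrite big_mkcond; apply: eq_bigr => k _; rewrite ltnS.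
by case: leqP => // /c0->; rewrite natpoly0 scale0r.
Qed.

(** Only the first r blocks of y's have letters x on their right to cross; the
    second argument of c counts these, including the p_i gained further right. *)
Definition ordering_coef (r : nat) (a b : 'I_r.+1 -> nat) (p : 'I_r -> nat) :=
  \prod_(l < r) c (b (widen_ord (leqnSn r) l)) (vtail a l + vtail p l) (p l).

(** A nonzero coefficient forces p_l <= b_l for every l.  The hypothesis rules this
    out, and it is exactly the case in which the exponent |b| - |p| of y is
    falsified by the truncation of the subtraction. *)
Lemma ordering_coef_eq0 (r : nat) (a b : 'I_r.+1 -> nat) (p : 'I_r -> nat) :
  (vsum b < vsum p)%N -> ordering_coef r a b p = 0.
Proof.
move=> lt_bp; have [_ c0] := normal_coordP C.
have [/forallP p_le|/forallPn[l]] :=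
    boolP [forall l, p l <= b (widen_ord (leqnSn r) l)]%N; last first.
  by rewrite -ltnNge /ordering_coef (bigD1 l) //= => /c0->; rewrite mul0r.
case/negP: (negbT (ltn_geF lt_bp)); rewrite /vsum big_ord_recr /=.
by apply: leq_trans (leq_addr _ _); apply: leq_sum => l _; exact: p_le.
Qed.

Lemma vtail0 (r : nat) (v : 'I_r.+1 -> nat) :
  vtail v 0 = vsum (fun i => v (lift ord0 i)).
Proof. by rewrite /vtail big_mkcond big_ord_recl /= add0n; apply: eq_bigr. Qed.

Lemma vtailS (r : nat) (v : 'I_r.+1 -> nat) l :
  vtail v l.+1 = vtail (fun i => v (lift ord0 i)) l.
Proof. by rewrite /vtail big_mkcond big_ord_recl /= add0n [RHS]big_mkcond. Qed.

(** Induction on the number of blocks, splitting off the leftmost one: the tail is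
    x^A y^B by induction, and y^(b_1) x^A is reordered by the definition of the
    normal coordinates. *)
Lemma normal_ordering (N r : nat) (a b : 'I_r.+1 -> nat) :
  (vsum b <= N)%N ->
  \prod_(i < r.+1) (x ^+ a i * y ^+ b i) =
  \sum_(p : {ffun 'I_r -> 'I_N.+1})
    natpoly C (ordering_coef r a b (fun l => p l)) *:
    (x ^+ (vsum a + vsum (fun l => p l)) * y ^+ (vsum b - vsum (fun l => p l))).
Proof.
elim: r a b => [|r IH] a b bN.
  rewrite (big_pred1 (ffun0 (card_ord 0))); last first.
    by move=> t; apply/esym/eqP/ffunP => -[].
  rewrite /ordering_coef /vsum big_ord0 natpoly1 scale1r !big_ord1 big_ord0.
  by rewrite addn0 subn0.
have vsumS (v : 'I_r.+2 -> nat) :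
    vsum v = (v ord0 + vsum (fun i => v (lift ord0 i)))%N.
  exact: big_ord_recl.
have b0N : (b ord0 <= N)%N by apply: leq_trans bN; rewrite vsumS leq_addr.
have b'N : (vsum (fun i => b (lift ord0 i)) <= N)%N.
  by apply: leq_trans bN; rewrite vsumS leq_addl.
rewrite big_ord_recl (IH (fun i => a (lift ord0 i)) (fun i => b (lift ord0 i))) //.
rewrite (big_finsert _ _ _ ord0) exchange_big mulr_sumr; apply: eq_bigr => p _.
rewrite -scalerAr; set A := (vsum _ + _)%N; set B := (vsum _ - _)%N.
(* The word is now x^(a_1) (y^(b_1) x^A) y^B. *)
rewrite -mulrA (mulrA _ (x ^+ A)) (normal_coord_sum _ _ _ b0N) mulr_suml.
rewrite mulr_sumr scaler_sumr; apply: eq_bigr => k _.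
rewrite -scalerAl -scalerAr scalerA.
have vsum_p :
    vsum (fun l => finsert ord0 k p l) = (k + vsum (fun l => p l))%N.
  rewrite /vsum big_ord_recl finsert_at; congr addn.
  by apply: eq_bigr => l _; rewrite finsert_lift.
have -> : ordering_coef r.+1 a b (fun l => finsert ord0 k p l) =
    c (b ord0) A k *
    ordering_coef r (fun i => a (lift ord0 i)) (fun i => b (lift ord0 i))
      (fun l => p l).
  rewrite /ordering_coef big_ord_recl finsert_at !vtail0; congr (c _ (_ + _)%N _ * _).
  - by congr b; apply: val_inj.
  - by apply: eq_bigr => l _; rewrite finsert_lift.
  apply: eq_bigr => l _; rewrite finsert_lift !vtailS; congr (c _ (_ + _)%N _).
  - by congr b; apply: val_inj.
  - by apply: eq_bigr => i _; rewrite finsert_lift.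
rewrite natpolyM mulrC.
(* The exponents of y only add up when both truncated differences are genuine;
   otherwise the coefficient is zero on both sides. *)
have [k_b|k_b] := leqP k (b ord0); last first.
  by have [_ c0] := normal_coordP C; rewrite c0 // natpoly0 mul0r !scale0r.
have [p_b|p_b] :=
    leqP (vsum (fun l => p l)) (vsum (fun i => b (lift ord0 i))); last first.
  by rewrite (ordering_coef_eq0 _ _ _ _ p_b) natpoly0 mulr0 !scale0r.
rewrite mulrA mulrA -exprD -mulrA -exprD vsum_p !vsumS /A /B.
congr (_ *: (x ^+ _ * y ^+ _)).
  by rewrite (addnC (nat_of_ord k)) !addnA.
by rewrite addnBA // addnBAC // subnDA.
Qed.

End NormalOrdering.

(** * Assembling the identity *)

(** Each family p with nonzero contribution occurs for exactly one k, namely the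
    one listing its sums.  The bound [B j <= N] makes these sums fit in the index
    type of k. *)
Lemma sum_by_entry_sums (V : nmodType) (n r N : nat) (B : 'I_n -> nat)
    (F : {ffun 'I_n -> {ffun 'I_r -> 'I_N.+1}} -> V) :
  (forall j, B j <= N)%N ->
  (forall (p : {ffun 'I_n -> {ffun 'I_r -> 'I_N.+1}}) j,
     (B j < vsum (fun l => p j l))%N -> F p = 0) ->
  \sum_p F p =
  \sum_(k : {ffun 'I_n -> 'I_N.+1} | [forall j, k j <= B j]%N)
  \sum_(p : {ffun 'I_n -> {ffun 'I_r -> 'I_N.+1}} |
          [forall j, vsum (fun l => p j l) == k j]) F p.
Proof.
move=> B_le F0.
pose below (p : {ffun 'I_n -> {ffun 'I_r -> 'I_N.+1}}) :=
  [forall j, vsum (fun l => p j l) <= B j]%N.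
pose sums (p : {ffun 'I_n -> {ffun 'I_r -> 'I_N.+1}}) : {ffun 'I_n -> 'I_N.+1} :=
  [ffun j => inord (vsum (fun l => p j l))].
have sumsE p j : below p -> sums p j = vsum (fun l => p j l) :> nat.
  move=> /forallP/(_ j) le_pB; rewrite ffunE inordK // ltnS.
  exact: leq_trans le_pB (B_le j).
rewrite (bigID below) /= [X in _ + X]big1 ?addr0; last first.
  by move=> p /forallPn[j]; rewrite -ltnNge => /F0.
rewrite (partition_big sums (fun k => [forall j, k j <= B j]%N)); last first.
  by move=> p below_p; apply/forallP => j; rewrite sumsE //; exact: (forallP below_p).
apply: eq_bigr => k /forallP k_le; apply: eq_bigl => p.
apply/andP/forallP => [[below_p /eqP <-] j|p_k]; first by rewrite sumsE.
have below_p : below p by apply/forallP => j; rewrite (eqP (p_k j)).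
by split=> //; apply/eqP/ffunP => j; apply: val_inj; rewrite /= sumsE //; exact/eqP.
Qed.

(** Distributing [normal_ordering] over the slots of each class in [sbar_prod]
    gives, for fixed s, the sum over all p; k enters by [sum_by_entry_sums].
    Counting the factors as r.+1 avoids the subtraction m - 1 in the index type
    of p. *)
Lemma sym_monomial_prod (C : numFieldType) (r n : nat)
    (a b : 'I_r.+1 -> 'I_n -> nat) :
  (\prod_(i < r.+1) sym_monomial C (a i) (b i)) *+ n`! ^ r =
  \sum_(s : {ffun 'I_r.+1 -> 'S_n} | fixes_first s)
  \sum_(k : {ffun 'I_n -> 'I_(entry_sum b).+1} |
          [forall j, k j <= vsum (permvec b s j)]%N)
  \sum_(p : {ffun 'I_n -> {ffun 'I_r -> 'I_(entry_sum b).+1}} |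
          [forall j, vsum (fun l => p j l) == k j])
    natpoly C (\prod_(j < n)
      ordering_coef C r (permvec a s j) (permvec b s j) (fun l => p j l)) *:
    sym_monomial C
      (fun j => vsum (permvec a s j) + k j)%N
      (fun j => vsum (permvec b s j) - k j)%N.
Proof.
set N := entry_sum b.
rewrite sbar_prod; apply: eq_bigr => s _.
pose A j := permvec a s j; pose B j := permvec b s j.
have -> : [ffun j => \prod_(i < r.+1)
      [ffun j0 => MWx C ^+ a i j0 * MWy C ^+ b i j0] ((s i)^-1 j)%g] =
    [ffun j => \sum_(p : {ffun 'I_r -> 'I_N.+1})
      natpoly C (ordering_coef C r (A j) (B j) (fun l => p l)) *:
      (MWx C ^+ (vsum (A j) + vsum (fun l => p l)) *
       MWy C ^+ (vsum (B j) - vsum (fun l => p l)))].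
  apply/ffunP => j; rewrite [LHS]ffunE [RHS]ffunE -normal_ordering.
    by apply: eq_bigr => i _; rewrite ffunE.
  exact: permvec_le_sum.
rewrite multilin_expand; last exact: sbar_multilin.
rewrite (sum_by_entry_sums _ _ _ _ (fun j => vsum (B j))); first last.
- move=> p j lt_Bp.
  by rewrite (bigD1 j) //= ordering_coef_eq0 // natpoly0 mul0r scale0r.
- by move=> j; exact: permvec_le_sum.
apply: eq_bigr => k _; apply: eq_bigr => p /forallP p_k.
rewrite natpoly_prod; congr (_ *: sbar _); apply/ffunP => j.
by rewrite [LHS]ffunE [RHS]ffunE (eqP (p_k j)).
Qed.

Theorem theorem14 (R : realType) (m n : nat) (hm : (0 < m)%N) (hn : (0 < n)%N)
    (a b : 'I_m -> 'I_n -> nat) :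
  (\prod_(i < m) sym_monomial R[i] (a i) (b i)) *+ n`! ^ (m - 1) =
  \sum_(s : {ffun 'I_m -> 'S_n} | fixes_first s)
  \sum_(k : {ffun 'I_n -> 'I_(entry_sum b).+1} |
          [forall j, k j <= vsum (permvec b s j)]%N)
  \sum_(p : {ffun 'I_n -> {ffun 'I_(m - 1) -> 'I_(entry_sum b).+1}} |
          [forall j, vsum (fun l => p j l) == k j])
    natpoly R[i]
      (\prod_(l < m - 1) \prod_(j < n)
         normal_coord R[i]
           (permvec b s j (widen_ord (leq_subr 1 m) l))
           (vtail (permvec a s j) l + vtail (fun l => p j l) l)
           (p j l))
    *: sym_monomial R[i]
         (fun j => vsum (permvec a s j) + k j)%N
         (fun j => vsum (permvec b s j) - k j)%N.
Proof.
(* The difference [m - 1] reduces to [r] only propositionally for [m = r.+1], so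
   the bound that mentions it is generalized first. *)
move: (leq_subr 1 m); rewrite subn1.
case: m hm a b => // r _ a b; rewrite /= => le_r.
rewrite sym_monomial_prod; apply: eq_bigr => s _; apply: eq_bigr => k _.
apply: eq_bigr => p _; rewrite exchange_big; congr (natpoly _ _ *: _).
apply: eq_bigr => j _; apply: eq_bigr => l _.
by congr (normal_coord _ (permvec _ _ _ _) _ _); apply: val_inj.
Qed.
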